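(* Let $\bm{\zeta}^0=\rho_0\mathcal{A}\bm{x}^0+\bm{\lambda}^0/\rho_0$ (with $\rho_0\neq 0$) be an arbitrary fixed-point initialization and consider the worst-case optimal step-size problem $$\underset{\rho\neq 0}{\text{minimize}}\quad \Phi(\rho)=\left\Vert \rho\,\mathcal{A}\bm{x}^\star+\tfrac{1}{\rho}\bm{\lambda}^\star-\bm{\zeta}^0\right\Vert^2 .$$ The optimal step-size $\rho^\star$ is given by a root of the polynomial (equivalent to the first-order optimality condition of this problem) $$\rho^4\Vert \mathcal{A}\bm{x}^\star\Vert^2-\rho^3\langle \mathcal{A}\bm{x}^\star,\bm{\zeta}^0\rangle+\rho\langle \bm{\lambda}^\star,\bm{\zeta}^0\rangle-\Vert\bm{\lambda}^\star\Vert^2=0,\qquad \rho\neq 0,$$ which is of degree at most 4 and therefore always admits a closed-form solution, specified as follows. 1. (Trivial) Suppose $\Vert\mathcal{A}\bm{x}^\star\Vert=0$ and $\Vert\bm{\lambda}^\star\Vert=0$. Then all feasible choices are equivalent, i.e. $\rho^\star\in[-\infty,+\infty]\setminus\{0\}$ is arbitrary. 2. (Partly trivial, useful primal) Suppose $\Vert\mathcal{A}\bm{x}^\star\Vert\neq 0$ and $\Vert\bm{\lambda}^\star\Vert=0$. (i) For $\bm{\zeta}^0=\bm{0}$, the optimal choice is $\rho^\star\to 0$, i.e. infinitely close to zero in absolute value. (ii) For $\bm{\zeta}^0\neq\bm{0}$, $\rho^\star=\langle \mathcal{A}\bm{x}^\star,\bm{\zeta}^0\rangle/\Vert\mathcal{A}\bm{x}^\star\Vert^2$.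 3. (Partly trivial, useful dual) Suppose $\Vert\mathcal{A}\bm{x}^\star\Vert=0$ and $\Vert\bm{\lambda}^\star\Vert\neq 0$. (i) For $\bm{\zeta}^0=\bm{0}$, the optimal choice is $\rho^\star\to\infty$ in absolute value. (ii) For $\bm{\zeta}^0\neq\bm{0}$, $\rho^\star=\Vert\bm{\lambda}^\star\Vert^2/\langle\bm{\lambda}^\star,\bm{\zeta}^0\rangle$. 4. (Non-trivial) Suppose $\Vert\mathcal{A}\bm{x}^\star\Vert\neq 0$ and $\Vert\bm{\lambda}^\star\Vert\neq 0$. (i) For $\bm{\zeta}^0=\bm{0}$, $\rho^\star=\pm\sqrt{\Vert\bm{\lambda}^\star\Vert/\Vert\mathcal{A}\bm{x}^\star\Vert}$. (ii) For $\bm{\zeta}^0\neq\bm{0}$, write the polynomial as $a\rho^4+b\rho^3+d\rho+e=0$, i.e. $a=\Vert\mathcal{A}\bm{x}^\star\Vert^2$, $b=-\langle\mathcal{A}\bm{x}^\star,\bm{\zeta}^0\rangle$, $d=\langle\bm{\lambda}^\star,\bm{\zeta}^0\rangle$, $e=-\Vert\bm{\lambda}^\star\Vert^2$. Its four roots are $$\tfrac12\left(-\tfrac{b}{2a}-u_4\pm\sqrt{u_5-u_6}\right),\qquad \tfrac12\left(-\tfrac{b}{2a}+u_4\pm\sqrt{u_5+u_6}\right),$$ where $$u_1=\tfrac{\sqrt{27}}{2}(ad^2+b^2e),\quad u_2=u_1+\sqrt{(bd-4ae)^3+u_1^2},\quad u_3=\tfrac{1}{\sqrt3\,a}\left(\sqrt[3]{u_2}-\tfrac{bd-4ae}{\sqrt[3]{u_2}}\right),$$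 $$u_4=\sqrt{\tfrac{b^2}{4a^2}+u_3},\quad u_5=\tfrac{b^2}{2a^2}-u_3,\quad u_6=-\frac{\frac{b^3}{a^3}+\frac{8d}{a}}{4u_4}.$$ After removing the complex roots, $\rho^\star$ is the one among the remaining roots that minimizes $\Phi$.
   Context: $\mathbb{H},\mathbb{P},\mathbb{K}$ are real Hilbert spaces; $\Gamma_0(\cdot)$ denotes the convex, closed, proper functions with values in $(-\infty,+\infty]$. Consider the convex program: minimize $f(\bm{x})+g(\bm{z})$ subject to $\mathcal{A}\bm{x}-\mathcal{B}\bm{z}=\bm{c}$, with $f\in\Gamma_0(\mathbb{H})$, $g\in\Gamma_0(\mathbb{P})$, $\bm{c}\in\mathbb{K}$, and $\mathcal{A}:\mathbb{H}\to\mathbb{K}$, $\mathcal{B}:\mathbb{P}\to\mathbb{K}$ injective bounded linear operators. A solution is assumed to exist: $\bm{x}^\star$ is the optimal primal solution and $\bm{\lambda}^\star\in\mathbb{K}$ the optimal Lagrange multiplier (dual solution) for the equality constraint. Since $\mathcal{A}$ is injective, $\Vert\mathcal{A}\bm{x}^\star\Vert=0$ if and only if $\bm{x}^\star=\bm{0}$. The domain step-size $\rho\neq0$ is related to the classical ADMM step-size $\gamma>0$ by $\gamma=\rho^2$. The vectors $\bm{x}^0$, $\bm{\lambda}^0$ and the scalar $\rho_0$ are the primal, dual and step-size initializations. The objective $\Phi(\rho)$ equals $\Vert\bm{\zeta}^\star-\bm{\zeta}^0\Vert^2$, where $\bm{\zeta}^\star=\rho\mathcal{A}\bm{x}^\star+\bm{\lambda}^\star/\rho$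 is the ADMM fixed-point, the limit of $\bm{\zeta}^{k+1}=\rho\mathcal{A}\bm{x}^{k+1}+\bm{\lambda}^k/\rho$ formed from the ADMM primal and dual iterates $\bm{x}^k,\bm{\lambda}^k$. It appears in the worst-case rate bound $\Vert\bm{\zeta}^{k+1}-\bm{\zeta}^k\Vert^2\le\frac{1}{k+1}\Vert\bm{\zeta}^\star-\bm{\zeta}^0\Vert^2$, and ''optimal step-size'' means one minimizing this bound.
   Formalization: In 4(ii) the roots in u_2, u_3, u_4 may be any complex determinations with nonzero u_2, u_4 (shown to exist; 0/0 is read as 0 in u_3 if u_1 = bd-4ae = 0), as principal ones can give 0/0; in 2(ii) a zero value means rho -> 0, in 3(ii) a zero denominator means |rho| -> infinity. *)

(* Defs.v *)
From HB Require Import structures.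
From mathcomp Require Import all_boot all_order all_algebra.
From mathcomp Require Import all_classical all_reals all_analysis.
From mathcomp Require Import complex.

Set Implicit Arguments.
Unset Strict Implicit.
Unset Printing Implicit Defensive.

Import Order.TTheory GRing.Theory Num.Theory.
Import numFieldNormedType.Exports.

Local Open Scope classical_set_scope.
Local Open Scope ring_scope.
Local Open Scope complex_scope.

(* A real Hilbert space is a complete normed module together with a positive
   definite symmetric form that induces its norm. *)
Definition hilbert_form (R : realType) (V : completeNormedModType R)
    (ip : {dot V for idfun}) : Prop :=
  forall v : V, ip v v = `|v| ^+ 2.

Definition Gamma0 (R : realType) (V : normedModType R) (f : V -> \bar R)
    : Prop :=
  [/\ forall x : V, f x != -oo%E,
      exists x : V, (f x < +oo)%E,
      forall (x y : V) (t : R), 0 <= t -> t <= 1 ->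
        (f (t *: x + (1 - t) *: y)%R
           <= t%:E * f x + (1 - t)%:E * f y)%E
    & lower_semicontinuous f].

Section ConvexProgram.
Context (R : realType) (H P K : completeNormedModType R).
Context (ip : {dot K for idfun}).
Context (f : H -> \bar R) (g : P -> \bar R).
Context (A : {linear H -> K}) (B : {linear P -> K}) (c : K).

Definition primal_solution (x : H) (z : P) : Prop :=
  [/\ A x - B z = c,
      (f x + g z < +oo)%E
    & forall (x' : H) (z' : P), A x' - B z' = c ->
        (f x + g z <= f x' + g z')%E].

(* This sign of the multiplier is the one for which the ADMM fixed point is
   rho A x + lambda / rho. *)
Definition lagrangian (x : H) (z : P) (lambda : K) : \bar R :=
  (f x + g z + (ip lambda (A x - B z - c)%R)%:E)%E.

Definition dual_function (lambda : K) : \bar R :=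
  ereal_inf [set lagrangian xz.1 xz.2 lambda | xz in [set: H * P]].

(* The last equation (no duality gap) is what makes a dual solution a Lagrange
   multiplier for the primal solution (x, z). *)
Definition dual_solution (x : H) (z : P) (lambda : K) : Prop :=
  (forall mu : K, (dual_function mu <= dual_function lambda)%E) /\
  dual_function lambda = (f x + g z)%E.

End ConvexProgram.

Definition fixed_point (R : realType) (H K : completeNormedModType R)
    (A : {linear H -> K}) (x : H) (lambda : K) (rho : R) : K :=
  rho *: A x + rho^-1 *: lambda.

Definition rate_bound (R : realType) (H K : completeNormedModType R)
    (A : {linear H -> K}) (x : H) (lambda zeta0 : K) (rho : R) : R :=
  `|fixed_point A x lambda rho - zeta0| ^+ 2.

(* Optimality of an extended step-size for the minimization of Phi over
   rho != 0.  The boundary values 0, +oo and -oo are not feasible; they are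
   optimal when Phi tends to its infimum as rho tends to them. *)
Definition optimal_step (R : realType) (Phi : R -> R) (r : \bar R) : Prop :=
  let m := inf [set Phi s | s in [set s : R | s != 0]] in
  match r with
  | EFin s => if s == 0 then Phi t @[t --> (0 : R)^'] --> m
              else forall t : R, t != 0 -> Phi s <= Phi t
  | +oo%E => Phi t @[t --> +oo_R] --> m
  | -oo%E => Phi t @[t --> -oo_R] --> m
  end.

Definition quartic (R : realType) (a b d e : R) : {poly R} :=
  a *: 'X^4 + b *: 'X^3 + d *: 'X + e%:P.

(* The radicals in the solution by radicals of
   a X^4 + b X^3 + d X + e are multivalued complex radicals, and principal
   determinations can make the denominators cbrt u2 or u4 vanish (u4 = 0 for
   b = d = 0, for instance).  A choice of determinations is therefore a
   parameter. *)
Record radicals (R : realType) := Radicals {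
  rad_sqrt_u2 : R[i];    (* the square root occurring in u2 *)
  rad_cbrt_u2 : R[i];    (* the cube root of u2 *)
  rad_u4 : R[i];
  rad_minus : R[i];      (* the square root of u5 - u6 *)
  rad_plus : R[i]        (* the square root of u5 + u6 *)
}.

Section Radicals.
Context (R : realType) (a b d e : R) (q : radicals R).

Definition quartic_u1 : R := Num.sqrt 27 / 2 * (a * d ^+ 2 + b ^+ 2 * e).

Definition quartic_u2 : R[i] := quartic_u1%:C + rad_sqrt_u2 q.

Definition quartic_u3 : R[i] :=
  (1 / (Num.sqrt 3 * a))%:C *
  (rad_cbrt_u2 q - (b * d - 4 * a * e)%:C / rad_cbrt_u2 q).

Definition quartic_u5 : R[i] := (b ^+ 2 / (2 * a ^+ 2))%:C - quartic_u3.

Definition quartic_u6 : R[i] :=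
  - ((b ^+ 3 / a ^+ 3 + 8 * d / a)%:C / (4 * rad_u4 q)).

(* When u1 = bd - 4ae = 0 every determination of u2 is zero (this is the case
   of a triple root).  The quotient (bd - 4ae) / cbrt u2 then reads 0 / 0, which
   is 0 here, and this value gives the right roots.  Otherwise u2 must not
   vanish. *)
Definition admissible_radicals : Prop :=
  [/\ rad_sqrt_u2 q ^+ 2
        = ((b * d - 4 * a * e) ^+ 3 + quartic_u1 ^+ 2)%:C,
      rad_cbrt_u2 q ^+ 3 = quartic_u2,
      rad_u4 q ^+ 2 = (b ^+ 2 / (4 * a ^+ 2))%:C + quartic_u3,
      rad_minus q ^+ 2 = quartic_u5 - quartic_u6
    & rad_plus q ^+ 2 = quartic_u5 + quartic_u6] /\
  (rad_u4 q != 0 /\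
   (quartic_u2 != 0 \/ (quartic_u1 = 0 /\ b * d - 4 * a * e = 0))).

Definition quartic_roots : seq R[i] :=
  [:: 1 / 2 * (- (b / (2 * a))%:C - rad_u4 q + rad_minus q);
      1 / 2 * (- (b / (2 * a))%:C - rad_u4 q - rad_minus q);
      1 / 2 * (- (b / (2 * a))%:C + rad_u4 q + rad_plus q);
      1 / 2 * (- (b / (2 * a))%:C + rad_u4 q - rad_plus q)].

End Radicals.

(* Main.v *)
Require Import Defs.
From HB Require Import structures.
From mathcomp Require Import all_boot all_order all_algebra.
From mathcomp Require Import all_classical all_reals all_analysis.
From mathcomp Require Import complex ring lra.

Set Implicit Arguments.
Unset Strict Implicit.
Unset Printing Implicit Defensive.

Import Order.TTheory GRing.Theory Num.Theory.
Import numFieldNormedType.Exports.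

Local Open Scope classical_set_scope.
Local Open Scope ring_scope.
Local Open Scope complex_scope.

(** Away from 0, Phi(rho) = a rho^2 + 2 b rho + k - 2 d / rho - e / rho^2, with
    the coefficients of the quartic p, and Phi'(rho) = 2 p(rho) / rho^3.  If
    e = d = 0 this is a quadratic polynomial in rho, and if a = b = 0 one in
    1 / rho.  If a > 0 > e, then Phi is coercive at 0 and at infinity, so that
    its minimum is attained, at a root of p.
    The radicals are Ferrari's: p / a splits into two quadratic factors that
    are determined by a square root u4 of b^2 / (4 a^2) + u3, with u3 a root of
    the resolvent cubic, found by Cardano's formula.  A nonzero u4 exists: if
    u2 <> 0, different cube roots give different u3; if u1 = bd - 4ae = 0, then
    u3 = 0 and b <> 0, since ae <> 0. *)

(** * Solution of the quartic by radicals *)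

(** Ferrari's method: with s = - b / (2 a), the quartic divided by a is (X^2 - (s - w) X + q1) (X^2
    - (s + w) X + q2), and m^2, n^2 are the discriminants of the two factors. *)
Lemma quartic_factorization (F : numFieldType) (a b d e u3 w m n : F) :
  a != 0 -> w != 0 ->
  a ^+ 3 * u3 ^+ 3 + a * (b * d - 4 * a * e) * u3 = a * d ^+ 2 + b ^+ 2 * e ->
  w ^+ 2 = b ^+ 2 / (4 * a ^+ 2) + u3 ->
  m ^+ 2 = b ^+ 2 / (2 * a ^+ 2) - u3
           + (b ^+ 3 / a ^+ 3 + 8 * d / a) / (4 * w) ->
  n ^+ 2 = b ^+ 2 / (2 * a ^+ 2) - u3
           - (b ^+ 3 / a ^+ 3 + 8 * d / a) / (4 * w) ->
  a *: 'X^4 + b *: 'X^3 + d *: 'X + e%:P =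
  a%:P * \prod_(z <- [:: 1 / 2 * (- (b / (2 * a)) - w + m);
                         1 / 2 * (- (b / (2 * a)) - w - m);
                         1 / 2 * (- (b / (2 * a)) + w + n);
                         1 / 2 * (- (b / (2 * a)) + w - n)]) ('X - z%:P).
Proof.
move=> a0 w0 resolvent w2 m2 n2.
have u3E : u3 = w ^+ 2 - b ^+ 2 / (4 * a ^+ 2) by rewrite w2; ring.
(* The resolvent equation is linear in [e], with coefficient 4 a^2 w^2 <> 0. Solving it for [e] is
   what makes the constant terms agree in [c0]. *)
have eE : e = (a ^+ 3 * u3 ^+ 3 + a * b * d * u3 - a * d ^+ 2)
              / (4 * a ^+ 2 * w ^+ 2).
  have -> : a ^+ 3 * u3 ^+ 3 + a * b * d * u3 - a * d ^+ 2 =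
            e * (b ^+ 2 + 4 * a ^+ 2 * u3).
    apply/eqP; rewrite -subr_eq0; move/eqP: resolvent.
    rewrite -subr_eq0 => /eqP <-.
    by apply/eqP; ring.
  have -> : b ^+ 2 + 4 * a ^+ 2 * u3 = 4 * a ^+ 2 * w ^+ 2.
    by rewrite u3E; field.
  by field; rewrite w0 a0.
set s := - (b / (2 * a)).
set q1 := ((s - w) ^+ 2 - m ^+ 2) / 4.
set q2 := ((s + w) ^+ 2 - n ^+ 2) / 4.
(* Comparison of the coefficients of X^3, X^2, X and 1. The quartic has no X^2 term, whence the 0 in
   [c2]. *)
have c3 : b = - a * (2 * s) by rewrite /s; field.
have c2 : 0 = a * (q1 + q2 + (s - w) * (s + w)).
  by rewrite /q1 /q2 m2 n2 u3E /s; field; rewrite w0 a0.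
have c1 : d = - a * (q1 * (s + w) + q2 * (s - w)).
  by rewrite /q1 /q2 m2 n2 u3E /s; field; rewrite w0 a0.
have c0 : e = a * (q1 * q2).
  by rewrite /q1 /q2 m2 n2 eE u3E /s; field; rewrite w0 a0.
rewrite !big_cons big_nil -!mul_polyC.
have pair (x y : F) : ('X - (1 / 2 * (x + y))%:P) * ('X - (1 / 2 * (x - y))%:P)
    = 'X^2 - x%:P * 'X + ((x ^+ 2 - y ^+ 2) / 4)%:P.
  rewrite (_ : (x ^+ 2 - y ^+ 2) / 4 = 1 / 2 * (x + y) * (1 / 2 * (x - y))).
    rewrite {3}(_ : x = 1 / 2 * (x + y) + 1 / 2 * (x - y)); last by field.
    by move: (1 / 2 * (x + y)) (1 / 2 * (x - y)) => X1 X2; ring.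
  by field.
rewrite mulr1 [X in _ = _ * X]mulrA !pair -/q1 -/q2.
have -> : a%:P * 'X^4 + b%:P * 'X^3 + d%:P * 'X + e%:P =
   a%:P * 'X^4 + b%:P * 'X^3 + 0%:P * 'X^2 + d%:P * 'X + e%:P by ring.
rewrite [in LHS]c3 c2 c1 c0.
by ring.
Qed.

(* With [v = c - p / c], [v ^ 3 + 3 p v = c ^ 3 - p ^ 3 / c ^ 3 = 2 u1]. *)
Lemma cardano_root (F : fieldType) (p u1 s c : F) :
  c != 0 \/ (u1 = 0 /\ p = 0) ->
  s ^+ 2 = p ^+ 3 + u1 ^+ 2 -> c ^+ 3 = u1 + s ->
  (c - p / c) ^+ 3 + 3 * p * (c - p / c) = 2 * u1.
Proof.
move=> cV s2 c3; have [c0|c0] := eqVneq c 0.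
  (* Here u1 = p = 0, and p / c is 0 by convention. *)
  case: cV => [|[u0 p0]]; first by rewrite c0 eqxx.
  by rewrite u0 p0 c0; ring.
(* p^3 = s^2 - u1^2 = (s + u1) (s - u1), and the first factor is c^3. *)
have p3 : p ^+ 3 = c ^+ 3 * (c ^+ 3 - 2 * u1) by rewrite c3; ring: s2.
transitivity (c ^+ 3 - p ^+ 3 / c ^+ 3); first by field.
by rewrite p3; field.
Qed.

(** The substitution v = sqrt 3 a u3 turns Cardano's depressed cubic into Ferrari's resolvent. Here
    [r] stands for sqrt 3, and 3 r / 2 for the factor sqrt 27 / 2 in u1. *)
Lemma resolvent_root (F : numFieldType) (a b d e r v : F) :
  a != 0 -> r ^+ 2 = 3 ->
  v ^+ 3 + 3 * (b * d - 4 * a * e) * v =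
    2 * (3 * r / 2 * (a * d ^+ 2 + b ^+ 2 * e)) ->
  let u3 := 1 / (r * a) * v in
  a ^+ 3 * u3 ^+ 3 + a * (b * d - 4 * a * e) * u3 = a * d ^+ 2 + b ^+ 2 * e.
Proof.
move=> a0 r2 vE /=.
have r0 : r != 0.
  apply/eqP => r0; move: r2; rewrite r0 => /eqP.
  by rewrite expr0n /= eq_sym pnatr_eq0.
have -> : a ^+ 3 * (1 / (r * a) * v) ^+ 3
   + a * (b * d - 4 * a * e) * (1 / (r * a) * v)
   = (v ^+ 3 + r ^+ 2 * (b * d - 4 * a * e) * v) / (r ^+ 2 * r).
  by field; rewrite a0 r0.
rewrite r2 vE; field; exact: r0.
Qed.

Lemma cube_root_of_unity (F : numClosedFieldType) :
  exists2 w : F, w != 1 & w ^+ 2 = - w - 1.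
Proof.
pose w : F := (- 1 + sqrtC (- 3)) / 2.
have w2 : w ^+ 2 = - w - 1 by rewrite /w; field: (sqrtCK (- 3 : F)).
exists w => //; apply/eqP => w1; move: w2; rewrite w1 => /eqP.
by rewrite -subr_eq0 (_ : _ - _ = 3%:R) ?pnatr_eq0 //; ring.
Qed.

(* The values of [c - p / c] at the three cube roots [c] of [u] are not all
   equal. *)
Lemma exists_cube_root (F : numClosedFieldType) (p u k : F) :
  u != 0 -> exists2 c : F, c ^+ 3 = u & c - p / c != k.
Proof.
move=> u0; have [w w1 w2] := cube_root_of_unity F.
pose c := 3.-root u.
have c3 : c ^+ 3 = u by rewrite /c rootCK.
have c0 : c != 0 by apply: contraNneq u0 => c0; rewrite -c3 c0 expr0n.
have w3 : w ^+ 3 = 1 by rewrite exprS w2 mulrBr mulrN -expr2 w2; ring.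
have w0 : w != 0.
  apply/eqP => z; move/eqP: w3.
  by rewrite z expr0n /= eq_sym oner_eq0.
have [k0|] := eqVneq (c - p / c) k; last by exists c.
have [k1|] := eqVneq (w * c - p / (w * c)) k; last first.
  by exists (w * c) => //; rewrite exprMn w3 mul1r.
exists (w ^+ 2 * c); first by rewrite exprMn -exprM mulnC exprM w3 expr1n mul1r.
apply/eqP => k2.
(* Suppose c, w c and w^2 c all give k. Divided by 1 - w, [E1] and [E2] become c^2 = p (1 + w) and p
   = c^2 (1 + w). As (1 + w)^2 = w, this yields c^2 = w c^2, which is impossible. The factor w^3 = 1
   is inserted so that 1 / w becomes w^2. *)
have E1 : c ^+ 2 * (1 - w) = p * (1 - w ^+ 2).
  have : (c - p / c) * c - (w * c - p / (w * c)) * c = 0.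
    by rewrite k0 k1 subrr.
  have -> : p / (w * c) = w ^+ 3 * p / (w * c) by rewrite w3 mul1r.
  move=> E; apply/eqP; rewrite -subr_eq0 -E; apply/eqP; field.
  by rewrite w0 c0.
have E2 : c ^+ 2 * (1 - w ^+ 2) = p * (1 - w).
  have : (c - p / c) * c - (w ^+ 2 * c - p / (w ^+ 2 * c)) * c = 0.
    by rewrite k0 k2 subrr.
  have -> : p / (w ^+ 2 * c) = w ^+ 3 * p / (w ^+ 2 * c) by rewrite w3 mul1r.
  move=> E; apply/eqP; rewrite -subr_eq0 -E; apply/eqP; field.
  by rewrite w0 c0.
have wB : 1 - w != 0 by rewrite subr_eq0 eq_sym.
have F1 : c ^+ 2 = p * (1 + w) by apply: (mulIf wB); rewrite E1; ring.
have F2 : c ^+ 2 * (1 + w) = p by apply: (mulIf wB); rewrite -E2; ring.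
have : c ^+ 2 * (1 - w) = 0.
  transitivity (c ^+ 2 - c ^+ 2 * (1 + w) * (1 + w)); last first.
    by rewrite F2 -F1 subrr.
  have -> : c ^+ 2 * (1 + w) * (1 + w) = c ^+ 2 * (1 + 2 * w + w ^+ 2) by ring.
  by rewrite w2; ring.
by move/eqP; rewrite mulf_eq0 expf_eq0 (negbTE c0) (negbTE wB).
Qed.

Lemma sqrt3K (R : realType) : Num.sqrt 3 ^+ 2 = 3 :> R.
Proof. by rewrite sqr_sqrtr. Qed.

Lemma sqrt27E (R : realType) : Num.sqrt 27 = 3 * Num.sqrt 3 :> R.
Proof.
rewrite (_ : 27 = 3 ^+ 2 * 3); last by ring.
by rewrite sqrtrM ?sqr_ge0 // sqrtr_sqr ger0_norm.
Qed.

(** The admissibility condition on u2 is what Cardano's formula requires: the cube root of u2 is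
    nonzero, or else u1 = bd - 4ae = 0. *)
Lemma quartic_u3_resolvent (R : realType) (a b d e : R) (q : radicals R) :
  a != 0 -> admissible_radicals a b d e q ->
  a%:C ^+ 3 * quartic_u3 a b d e q ^+ 3
    + a%:C * (b%:C * d%:C - 4 * a%:C * e%:C) * quartic_u3 a b d e q
  = a%:C * d%:C ^+ 2 + b%:C ^+ 2 * e%:C.
Proof.
move=> a0 [[s2 c3 _ _ _] [_ u2V]].
set p := b * d - 4 * a * e in s2 u2V.
have u1E : (quartic_u1 a b d e)%:C = 3 * (Num.sqrt 3)%:C / 2 *
    (a%:C * d%:C ^+ 2 + b%:C ^+ 2 * e%:C).
  by rewrite /quartic_u1 sqrt27E; field.
have pE : p%:C = b%:C * d%:C - 4 * a%:C * e%:C by rewrite /p; ring.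
have vE : (rad_cbrt_u2 q - p%:C / rad_cbrt_u2 q) ^+ 3
    + 3 * p%:C * (rad_cbrt_u2 q - p%:C / rad_cbrt_u2 q)
    = 2 * (quartic_u1 a b d e)%:C.
  apply: (@cardano_root _ _ _ (rad_sqrt_u2 q)) => //.
    case: u2V => [u2|[-> ->]]; last by right.
    by left; apply: contraNneq u2 => c0; rewrite -c3 c0 expr0n.
  by rewrite s2 rmorphD !rmorphXn.
rewrite /quartic_u3 -/p.
have -> : (1 / (Num.sqrt 3 * a))%:C = 1 / ((Num.sqrt 3)%:C * a%:C) :> R[i].
  by rewrite rmorphM rmorph1 fmorphV rmorphM.
apply: resolvent_root.
- by rewrite fmorph_eq0.
- by rewrite -rmorphXn sqrt3K; ring.
- by rewrite -pE vE u1E.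
Qed.

(** Ferrari's argument uses only the equations satisfied by the radicals and u4 <> 0, so every
    admissible choice of determinations gives the four roots. *)
Lemma quartic_roots_factorization (R : realType) (a b d e : R)
    (q : radicals R) :
  a != 0 -> admissible_radicals a b d e q ->
  map_poly (fun t : R => t%:C) (quartic a b d e)
  = (a%:C)%:P * \prod_(z <- quartic_roots a b q) ('X - z%:P).
Proof.
move=> a0 adm; have resolvent := quartic_u3_resolvent a0 adm.
have aC0 : a%:C != 0 :> R[i] by rewrite fmorph_eq0.
case: adm => [[_ _ w2 m2 n2] [w0 _]].
rewrite /quartic !rmorphD /= !map_polyZ /= !map_polyXn map_polyX map_polyC /=.
rewrite /quartic_roots (_ : (b / (2 * a))%:C = b%:C / (2 * a%:C)); last first.
  by field.
apply: (quartic_factorization aC0 w0 resolvent).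
- by rewrite w2; field.
- by rewrite m2 /quartic_u5 /quartic_u6; field; rewrite w0.
- by rewrite n2 /quartic_u5 /quartic_u6; field; rewrite w0.
Qed.

Lemma admissible_radicals_exist (R : realType) (a b d e : R) :
  a != 0 -> e != 0 -> exists q : radicals R, admissible_radicals a b d e q.
Proof.
move=> a0 e0.
have aC0 : a%:C != 0 :> R[i] by rewrite fmorph_eq0.
set p := b * d - 4 * a * e; set u1 := quartic_u1 a b d e.
pose r : R[i] := (Num.sqrt 3)%:C.
have r0 : r != 0 by rewrite fmorph_eq0 sqrtr_eq0 -ltNge.
(* Only s and c need care: the other radicals are square roots of given complex numbers, and the
   third condition ensures u4 <> 0. *)
suff [s [c [s2 c3 w0 u2V]]] : exists s c : R[i],
    [/\ s ^+ 2 = (p ^+ 3 + u1 ^+ 2)%:C, c ^+ 3 = u1%:C + s,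
       (b ^+ 2 / (4 * a ^+ 2))%:C
         + (1 / (Num.sqrt 3 * a))%:C * (c - p%:C / c) != 0
     & u1%:C + s != 0 \/ (u1 = 0 /\ p = 0)].
  pose w := sqrtC ((b ^+ 2 / (4 * a ^+ 2))%:C
                   + (1 / (Num.sqrt 3 * a))%:C * (c - p%:C / c)).
  pose q0 := Radicals s c w 0 0.
  pose u5 := quartic_u5 a b d e q0; pose u6 := quartic_u6 a b d q0.
  exists (Radicals s c w (sqrtC (u5 - u6)) (sqrtC (u5 + u6))).
  split; last by split; rewrite // /w sqrtC_eq0.
  by split; rewrite //= sqrtCK.
have [/andP[/eqP u0 /eqP p0]|up] := boolP ((u1 == 0) && (p == 0)).
  have b0 : b != 0.
    apply/eqP => b0; move/eqP: p0; apply/negP.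
    by rewrite /p b0 mul0r sub0r oppr_eq0 !mulf_neq0.
  exists 0, 0; rewrite u0 p0 !expr0n /= addr0; split => //; last by right.
    by rewrite addr0.
  rewrite mul0r subr0 mulr0 addr0 fmorph_eq0.
  by rewrite ?(mulf_neq0, invr_neq0, sqrf_eq0).
have [s s2 u2] : exists2 s : R[i],
    s ^+ 2 = (p ^+ 3 + u1 ^+ 2)%:C & u1%:C + s != 0.
  pose s : R[i] := sqrtC (p ^+ 3 + u1 ^+ 2)%:C.
  have s2 : s ^+ 2 = (p ^+ 3 + u1 ^+ 2)%:C by rewrite sqrtCK.
  (* Both signs of s fail only if u1 = s = 0, hence p = 0, which is excluded here. *)
  have [us|] := eqVneq (u1%:C + s) 0; last by exists s.
  exists (- s); rewrite ?sqrrN //; apply: contraNneq up => us'.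
  have u0 : u1 = 0.
    apply: complexI; rewrite rmorph0.
    transitivity (((u1%:C + s) + (u1%:C - s)) / 2); first by field.
    by rewrite us us' addr0 mul0r.
  move: us s2; rewrite u0 rmorph0 add0r => -> /eqP.
  by rewrite !expr0n addr0 eq_sym fmorph_eq0 expf_eq0 /= eqxx => ->.
(* The value that c - p / c has to avoid is the one at which u4^2 vanishes. *)
have [c c3 cN] := exists_cube_root p%:C
  (- ((b ^+ 2 / (4 * a ^+ 2))%:C * (r * a%:C))) u2.
exists s, c; split => //; last by left.
apply: contraNneq cN => w0; rewrite -subr_eq0 opprK.
have -> : (b ^+ 2 / (4 * a ^+ 2))%:C =
    - ((1 / (Num.sqrt 3 * a))%:C * (c - p%:C / c)).
  by apply/eqP; rewrite -addr_eq0 w0.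
rewrite mulNr.
have -> : (1 / (Num.sqrt 3 * a))%:C = 1 / (r * a%:C) :> R[i].
  by rewrite rmorphM rmorph1 fmorphV rmorphM.
have ra0 : r * a%:C != 0 by rewrite mulf_neq0.
by rewrite mul1r mulrAC mulVf // mul1r subrr.
Qed.

(** * The objective as a Laurent polynomial *)

(** The expanded square in Phi, with k = 2 <Ax, lambda> + |zeta0|^2 and the signs of the
    coefficients of the quartic. *)
Definition step_cost (R : realType) (a b d e k t : R) : R :=
  a * t ^+ 2 + 2 * b * t + k - 2 * d * t^-1 - e * t^-1 ^+ 2.

(** Inversion exchanges 0 with infinity and the primal coefficients with the dual ones, so
    coercivity at 0 follows from coercivity at infinity. *)
Lemma step_cost_inv (R : realType) (a b d e k t : R) :
  step_cost a b d e k t^-1 = step_cost (- e) (- d) (- b) (- a) k t.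
Proof. by rewrite /step_cost invrK; ring. Qed.

Lemma is_derive_step_cost (R : realType) (a b d e k t : R) : t != 0 ->
  is_derive t 1 (step_cost a b d e k) (2 * (quartic a b d e).[t] / t ^+ 3).
Proof.
move=> t0.
have dI : is_derive t 1 (id : R -> R) 1 by exact: is_derive_id.
have dV : is_derive t 1 (fun x : R => x^-1) (- t ^- 2).
  by have := is_deriveV (f := id) t0 dI; rewrite /GRing.scale /= mulr1.
have -> : step_cost a b d e k =
  (a *: (id ^+ 2) + (2 * b) *: id + cst k - (2 * d) *: (fun x => x^-1)
    - e *: ((fun x : R => x^-1) ^+ 2)) :> (R -> R).
  by apply/funext.
have dE := is_deriveB (is_deriveB (is_deriveD (is_deriveD
  (is_deriveZ a (is_deriveX 2 dI)) (is_deriveZ (2 * b) dI))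
  (is_derive_cst k t 1)) (is_deriveZ (2 * d) dV))
  (is_deriveZ e (is_deriveX 2 dV)).
apply: is_derive_eq dE _.
rewrite /quartic !hornerE /= /GRing.scale /=.
by field.
Qed.

Lemma step_cost_coercive (R : realType) (a b d e k M : R) :
  0 < a -> e <= 0 ->
  exists2 N : R, 0 < N & forall t, N <= `|t| -> M <= step_cost a b d e k t.
Proof.
move=> a0 e0.
(* For |t| >= 1 + s / a, both |t| >= 1 and a t^2 >= s |t| hold. The summands of [s] then absorb the
   linear term, the 1 / t term, k and M, while - e / t^2 is nonnegative. *)
pose s := 2 * `|b| + 2 * `|d| + `|k| + `|M|.
have s0 : 0 <= s by rewrite !addr_ge0 ?mulr_ge0.
exists (1 + s / a); first by rewrite ltr_wpDr ?divr_ge0 // ltW.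
move=> t Nt.
have t1 : 1 <= `|t| by apply: le_trans Nt; rewrite lerDl divr_ge0 // ltW.
have aNt : s <= a * `|t|.
  rewrite mulrC -ler_pdivrMr //; apply: le_trans Nt; lra.
have t2 : t ^+ 2 = `|t| ^+ 2 by rewrite real_normK ?num_real.
have V1 : `|t^-1| <= 1 by rewrite normfV invf_le1 // (lt_le_trans ltr01).
have bt : - (`|b| * `|t|) <= b * t by rewrite -normrM lerNnormlW.
have dt : d * t^-1 <= `|d|.
  apply: le_trans (ler_norm _) _; rewrite normrM.
  by rewrite -[leRHS]mulr1 ler_wpM2l.
have et : e * t^-1 ^+ 2 <= 0 by rewrite mulr_le0_ge0 // sqr_ge0.
have kk : - `|k| <= k by rewrite lerNnormlW.
have MM : M <= `|M| by rewrite ler_norm.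
have sq : s * `|t| <= a * t ^+ 2 by rewrite t2 expr2 mulrA ler_wpM2r.
have : (2 * `|d| + `|k| + `|M|) * 1 <= (2 * `|d| + `|k| + `|M|) * `|t|.
  by rewrite ler_wpM2l // !addr_ge0 ?mulr_ge0.
rewrite /step_cost; move: sq; rewrite /s => sq; lra.
Qed.

Lemma step_cost_coercive0 (R : realType) (a b d e k M : R) :
  0 <= a -> e < 0 ->
  exists2 N : R, 0 < N &
    forall t, t != 0 -> `|t| <= N -> M <= step_cost a b d e k t.
Proof.
move=> a0 e0.
have [||N N0 NM] := @step_cost_coercive R (- e) (- d) (- b) (- a) k M.
- by rewrite oppr_gt0.
- by rewrite oppr_le0.
exists N^-1; first by rewrite invr_gt0.
move=> t t0 tN; rewrite -[t]invrK step_cost_inv; apply: NM.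
by rewrite normfV -[N]invrK lef_pV2 ?posrE ?normr_gt0 ?invr_gt0.
Qed.

Lemma step_cost_min (R : realType) (a b d e k : R) : 0 < a -> e < 0 ->
  exists2 s : R, s != 0 &
    forall t, t != 0 -> step_cost a b d e k s <= step_cost a b d e k t.
Proof.
move=> a0 e0; set f := step_cost a b d e k.
have [N' N'0 N'f] := step_cost_coercive b d k (f 1) a0 (ltW e0).
have [n' n'0 n'f] := step_cost_coercive0 b d k (f 1) (ltW a0) e0.
(* Where |t| > N or |t| < n, the cost is at least [f 1]. Since n <= 1 <= N, it suffices to minimize
   over the two compact intervals where n <= |t| <= N. *)
pose N := Num.max N' 1; pose n := Num.min n' 1.
have n0 : 0 < n by rewrite lt_min n'0 ltr01.
have n1 : n <= 1 by rewrite ge_min lexx orbT.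
have N1 : 1 <= N by rewrite le_max lexx orbT.
have nN : n <= N by exact: le_trans n1 N1.
have df t : t != 0 -> derivable f t 1.
  by move=> t0; have [] := is_derive_step_cost a b d e k t0.
have [||c1 c1P c1f] := @EVT_min _ f n N; first by [].
  apply: derivable_within_continuous => t; rewrite in_itv /= => /andP[nt _].
  by apply: df; rewrite gt_eqF // (lt_le_trans n0).
have [||c2 c2P c2f] := @EVT_min _ f (- N) (- n); first by rewrite lerN2.
  apply: derivable_within_continuous => t; rewrite in_itv /= => /andP[_ nt].
  by apply: df; rewrite lt_eqF // (le_lt_trans nt) // oppr_lt0.
have c10 : c1 != 0.
  move: c1P; rewrite in_itv /= => /andP[nt _].
  by rewrite gt_eqF // (lt_le_trans n0).
have c20 : c2 != 0.
  move: c2P; rewrite in_itv /= => /andP[_ nt].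
  by rewrite lt_eqF // (le_lt_trans nt) // oppr_lt0.
have [c c0 [cc1 cc2]] : exists2 c, c != 0 & f c <= f c1 /\ f c <= f c2.
  by have [|/ltW] := leP (f c1) (f c2); [exists c1|exists c2].
have cf1 : f c <= f 1 by apply: le_trans cc1 (c1f _ _); rewrite in_itv /= n1.
exists c => // t t0.
have [tN|Nt] := leP `|t| N; last first.
  apply: le_trans cf1 (N'f _ _); apply: le_trans (ltW Nt).
  by rewrite le_max lexx.
have [nt|tn] := leP n `|t|; last first.
  apply: le_trans cf1 (n'f _ t0 _); apply: le_trans (ltW tn) _.
  by rewrite ge_min lexx.
have [t_gt0|t_lt0] := ltP 0 t.
  apply: le_trans cc1 (c1f _ _); rewrite in_itv /=.
  by rewrite -(gtr0_norm t_gt0) nt.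
apply: le_trans cc2 (c2f _ _); rewrite in_itv /=.
by rewrite -[t]opprK -(ler0_norm t_lt0) !lerN2 nt tN.
Qed.

(** * Optimality among extended step-sizes *)

Lemma optimal_step_fin (R : realType) (Phi : R -> R) (s : R) : s != 0 ->
  optimal_step Phi s%:E <-> forall t, t != 0 -> Phi s <= Phi t.
Proof. by move=> /negbTE s0; rewrite /optimal_step /= s0. Qed.

(** The infimum and the three limits see nonzero points only. This disposes of the value at 0, where
    Phi and its expansion may differ because 0^-1 = 0. *)
Lemma eq_optimal_step (R : realType) (Phi Psi : R -> R) (r : \bar R) :
  (forall t, t != 0 -> Phi t = Psi t) ->
  optimal_step Phi r <-> optimal_step Psi r.
Proof.
suff imp f g : (forall t, t != 0 -> f t = g t) ->
    optimal_step f r -> optimal_step g r.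
  by move=> E; split; apply: imp => // t t0; rewrite E.
move=> E; rewrite /optimal_step.
have -> : [set f s | s in [set s | s != 0]] = [set g s | s in [set s | s != 0]].
  by apply: eq_imagel => t /=; exact: E.
case: r => [s||].
- have [_|s0] := eqVneq s 0; last by move=> fm t t0; rewrite -!E //; exact: fm.
  apply: cvg_trans; apply: near_eq_cvg.
  by near=> t; apply/E; near: t; exact: nbhs_dnbhs_neq.
- apply: cvg_trans; apply: near_eq_cvg.
  by near=> t; apply/E; near: t; exists 0; split => // t /gt_eqF ->.
- apply: cvg_trans; apply: near_eq_cvg.
  by near=> t; apply/E; near: t; exists 0; split => // t /lt_eqF ->.
Unshelve. all: by end_near. Qed.

Lemma inf_step_eq (R : realType) (Phi : R -> R) (k : R) :
  (forall t, t != 0 -> k <= Phi t) ->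
  (forall eps, 0 < eps -> exists2 t, t != 0 & Phi t < k + eps) ->
  inf [set Phi s | s in [set s : R | s != 0]] = k.
Proof.
move=> lb adh; apply/eqP; rewrite eq_le; apply/andP; split.
  apply/ler_addgt0Pr => eps eps0; have [t t0 tk] := adh _ eps0.
  apply: le_trans (ltW tk); apply: ge_inf; last by exists t.
  by exists k => _ [s s0 <-]; exact: lb.
apply: lb_le_inf; first by exists (Phi 1), 1 => //=; exact: oner_neq0.
by move=> _ [s s0 <-]; exact: lb.
Qed.

Lemma not_cvg_coercive (R : realType) (f : R -> R) (F : set_system R) (m : R) :
  ProperFilter F -> (forall M, \forall t \near F, M <= f t) ->
  ~ (f t @[t --> F] --> m).
Proof.
move=> FF fM /cvgrPdist_lt /(_ 1 ltr01) fm.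
have [t []] := filter_ex (filterI (fM (m + 1)) fm).
rewrite ltr_norml => /[swap] /andP[+ _] => h1 h2; lra.
Qed.

(** At an infinite optimal step the cost would tend to a real number, against coercivity. *)
Lemma optimal_step_coercive (R : realType) (a b d e k : R) (r : \bar R) :
  0 < a -> e <= 0 -> optimal_step (step_cost a b d e k) r ->
  exists s, r = s%:E.
Proof.
move=> a0 e0; case: r => [s _|/=|/=]; first by exists s.
- move/not_cvg_coercive; case => M.
  have [N N0 NM] := step_cost_coercive b d k M a0 e0.
  exists N; split; first exact: num_real.
  by move=> t Nt; apply: NM; rewrite gtr0_norm ?ltW // (lt_trans N0).
- move/not_cvg_coercive; case => M.
  have [N N0 NM] := step_cost_coercive b d k M a0 e0.
  exists (- N); split; first exact: num_real.
  move=> t tN; apply: NM; rewrite ltr0_norm; first by rewrite lerNr ltW.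
  by rewrite (lt_trans tN) // oppr_lt0.
Qed.

Lemma optimal_step_coercive0 (R : realType) (a b d e k : R) :
  0 <= a -> e < 0 -> ~ optimal_step (step_cost a b d e k) 0%:E.
Proof.
move=> a0 e0; rewrite /optimal_step /= eqxx; apply: not_cvg_coercive => M.
have [N N0 NM] := step_cost_coercive0 b d k M a0 e0.
near=> t; apply: NM; first by near: t; exact: nbhs_dnbhs_neq.
near: t; apply: dnbhs0_le => //.
Unshelve. all: by end_near. Qed.

(** Coercivity at 0 and at infinity excludes all boundary values, so that only ordinary minimizers
    remain. *)
Lemma optimal_step_nontrivial (R : realType) (a b d e k : R) (r : \bar R) :
  0 < a -> e < 0 ->
  optimal_step (step_cost a b d e k) r <->
  exists s, [/\ r = s%:E, s != 0 &
    forall t, t != 0 -> step_cost a b d e k s <= step_cost a b d e k t].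
Proof.
move=> a0 e0; split=> [opt|[s [-> s0 /optimal_step_fin]]]; last exact.
have [s rs] := optimal_step_coercive a0 (ltW e0) opt.
have s0 : s != 0.
  apply/eqP => s0; apply: (optimal_step_coercive0 (ltW a0) e0).
  by move: opt; rewrite rs s0; exact.
by exists s; split => //; apply/optimal_step_fin; rewrite -?rs.
Qed.

Lemma optimal_step_root (R : realType) (a b d e k s : R) : s != 0 ->
  optimal_step (step_cost a b d e k) s%:E -> root (quartic a b d e) s.
Proof.
move=> s0 /(optimal_step_fin _ s0) smin.
(* The interval of radius |s| / 2 around s avoids 0, so s is an interior minimum of a differentiable
   function there. *)
pose l := `|s| / 2.
have l0 : 0 < l by rewrite divr_gt0 ?normr_gt0.
have nz t : t \in `]s - l, s + l[ -> t != 0.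
  rewrite in_itv /= => tI; apply: contraTneq tI => ->.
  apply/negP => /andP[A B]; have [s_gt0|s_le0] := ltP 0 s.
    move: A B; rewrite /l gtr0_norm //; clear l l0; lra.
  move: A B; rewrite /l ler0_norm //; clear l l0; lra.
have [||||dv E] := @derive1_at_min _ (step_cost a b d e k) (s - l) (s + l) s.
- lra.
- by move=> t /nz t0; have [] := is_derive_step_cost a b d e k t0.
- by rewrite in_itv /=; lra.
- by move=> t /nz; exact: smin.
have [_] := is_derive_step_cost a b d e k s0.
rewrite E => /esym/eqP; rewrite !mulf_eq0 invr_eq0 expf_eq0 /= pnatr_eq0 /=.
by rewrite (negbTE s0) orbF.
Qed.

(** * Primal and dual cases: quadratics in rho or 1 / rho *)

Lemma quadratic_square (R : realType) (a b k t : R) : a != 0 ->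
  a * t ^+ 2 + 2 * b * t + k = k - b ^+ 2 / a + a * (t - - b / a) ^+ 2.
Proof. by move=> a0; field. Qed.

Lemma quadratic_min (R : realType) (a b k s : R) : 0 < a -> s != 0 ->
  (forall t, t != 0 ->
     a * s ^+ 2 + 2 * b * s + k <= a * t ^+ 2 + 2 * b * t + k) <->
  s = - b / a.
Proof.
move=> a0 s0; have aN0 : a != 0 by rewrite gt_eqF.
split=> [smin|sE t t0]; last first.
  rewrite !(quadratic_square _ _ _ aN0) -sE subrr expr0n mulr0 addr0 lerDl.
  by rewrite mulr_ge0 ?sqr_ge0 // ltW.
have {}smin t : t != 0 -> (s - - b / a) ^+ 2 <= (t - - b / a) ^+ 2.
  by move=> /smin; rewrite !(quadratic_square _ _ _ aN0) lerD2l ler_pM2l.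
(* The vertex may be the infeasible point 0. Then no nonzero s is a minimizer, since s / 2 does
   better. *)
have [r0|r0] := eqVneq (- b / a) 0; last first.
  have /le_anti/eqP : (s - - b / a) ^+ 2 <= 0 <= (s - - b / a) ^+ 2.
    by rewrite sqr_ge0 andbT; have := smin _ r0; rewrite subrr expr0n.
  by rewrite sqrf_eq0 subr_eq0 => /eqP.
have s2 : 0 < s ^+ 2 by rewrite lt_neqAle sqr_ge0 eq_sym sqrf_eq0 s0.
have := smin (s / 2); rewrite r0 !subr0 expr_div_n mulf_neq0 ?invr_neq0 //.
by move=> /(_ isT); lra.
Qed.

Lemma quadratic_adherent (R : realType) (a b k eps : R) : 0 < a -> 0 < eps ->
  exists2 t, t != 0 & a * t ^+ 2 + 2 * b * t + k < k - b ^+ 2 / a + eps.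
Proof.
move=> a0 eps0; have aN0 : a != 0 by rewrite gt_eqF.
have [r0|r0] := eqVneq (- b / a) 0; last first.
  exists (- b / a) => //.
  by rewrite (quadratic_square _ _ _ aN0) subrr expr0n mulr0 addr0 ltrDl.
(* With the vertex at 0, this t gives a t^2 <= a t <= eps / 2. *)
pose t := Num.min 1 (eps / (2 * a)).
have t0 : 0 < t by rewrite lt_min ltr01 divr_gt0 // mulr_gt0.
have t1 : t <= 1 by rewrite ge_min lexx.
have at_eps : t * (2 * a) <= eps.
  by rewrite -ler_pdivlMr ?mulr_gt0 // ge_min lexx orbT.
exists t; first by rewrite gt_eqF.
rewrite (quadratic_square _ _ _ aN0) r0 subr0 ltrD2l.
have : a * t ^+ 2 <= a * t by rewrite ler_pM2l // expr2 ler_piMr // ltW.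
lra.
Qed.

(** By continuity the limit is the value at u, which exceeds the minimum by a (u + b / a)^2. It is
    applied with [f] the identity at 0 or the inverse at infinity, so that u = 0. *)
Lemma quadratic_cvg_min (R : realType) (F : set_system R) (f : R -> R)
    (a b k u : R) : ProperFilter F -> 0 < a -> f t @[t --> F] --> u ->
  (a * f t ^+ 2 + 2 * b * f t + k @[t --> F] --> k - b ^+ 2 / a)
  <-> u = - b / a.
Proof.
move=> FF a0 fu; have aN0 : a != 0 by rewrite gt_eqF.
have lim : a * f t ^+ 2 + 2 * b * f t + k @[t --> F] -->
           a * u ^+ 2 + 2 * b * u + k.
  apply: cvgD (cvg_cst _); apply: cvgD; apply: cvgM (cvg_cst _) _ => //.
  by rewrite !expr2; exact: cvgM.
rewrite (quadratic_square _ _ _ aN0) in lim.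
split=> [lim'|uE]; last by move: lim; rewrite uE subrr expr0n mulr0 addr0.
have limE : k - b ^+ 2 / a + a * (u - - b / a) ^+ 2 = k - b ^+ 2 / a.
  exact: norm_cvg_unique lim lim'.
move/eqP: limE.
rewrite -subr_eq0 addrAC subrr add0r mulf_eq0 (negbTE aN0) sqrf_eq0 subr_eq0.
by move/eqP.
Qed.

(** [f] is an involution of the nonzero reals, the identity or the inverse, and so leaves the
    infimum unchanged. *)
Lemma inf_step_quadratic (R : realType) (Phi f : R -> R) (a b k : R) :
  0 < a -> (forall t, t != 0 -> f t != 0) ->
  (forall t, t != 0 -> f (f t) = t) ->
  (forall t, t != 0 -> Phi t = a * f t ^+ 2 + 2 * b * f t + k) ->
  inf [set Phi s | s in [set s : R | s != 0]] = k - b ^+ 2 / a.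
Proof.
move=> a0 f0 fK PhiE; have aN0 : a != 0 by rewrite gt_eqF.
apply: inf_step_eq => [t t0|eps eps0].
  rewrite PhiE // (quadratic_square _ _ _ aN0) lerDl.
  by rewrite mulr_ge0 ?sqr_ge0 // ltW.
have [t t0 lt_t] := quadratic_adherent b k a0 eps0.
by exists (f t); rewrite ?f0 // PhiE ?f0 // fK.
Qed.

Lemma step_costa0 (R : realType) (a b k t : R) :
  step_cost a b 0 0 k t = a * t ^+ 2 + 2 * b * t + k.
Proof. by rewrite /step_cost; ring. Qed.

Lemma step_cost0e (R : realType) (d e k t : R) :
  step_cost 0 0 d e k t = (- e) * t^-1 ^+ 2 + 2 * (- d) * t^-1 + k.
Proof. by rewrite /step_cost; ring. Qed.

(** If b = 0, the vertex is 0 and the same formula denotes the boundary step 0, approached but not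
    attained. *)
Lemma optimal_step_primal (R : realType) (a b k : R) (r : \bar R) : 0 < a ->
  optimal_step (step_cost a b 0 0 k) r <-> r = (- b / a)%:E.
Proof.
move=> a0; have fin r' : optimal_step (step_cost a b 0 0 k) r' ->
    exists s, r' = s%:E by exact: optimal_step_coercive.
case: r => [s||]; try by split=> // /fin[].
have [->|s0] := eqVneq s 0.
  rewrite /optimal_step /= eqxx.
  rewrite (@inf_step_quadratic _ _ id a b k) //; last first.
    by move=> t _; rewrite step_costa0.
  under eq_fun do rewrite step_costa0.
  have id0 : (t : R) @[t --> 0^'] --> 0 by apply/(continuous_withinNx id 0).
  by rewrite (quadratic_cvg_min _ _ _ a0 id0); split => [->|[]].
rewrite optimal_step_fin //.
have -> : (s%:E = (- b / a)%:E) = (s = - b / a).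
  by apply/propext; split => [[]|->].
rewrite -(quadratic_min _ k a0 s0).
by split=> smin t /smin; rewrite !step_costa0.
Qed.

Lemma cvg_invry (R : realType) : t^-1 @[t --> +oo_R] --> (0 : R).
Proof.
apply/cvgrPdist_lt => eps eps0; exists eps^-1; split; first exact: num_real.
move=> t et; have t0 : 0 < t by apply: lt_trans et; rewrite invr_gt0.
rewrite sub0r normrN gtr0_norm ?invr_gt0 //.
by rewrite -[eps]invrK ltf_pV2 ?posrE ?invr_gt0.
Qed.

Lemma cvg_invrNy (R : realType) : t^-1 @[t --> -oo_R] --> (0 : R).
Proof.
apply/cvgrPdist_lt => eps eps0; exists (- eps^-1); split; first exact: num_real.
move=> t et; have t0 : 0 < - t.
  by rewrite ltrNr oppr0 (lt_trans et) ?oppr_lt0 ?invr_gt0.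
rewrite sub0r -invrN gtr0_norm ?invr_gt0 //.
by rewrite -[eps]invrK ltf_pV2 ?posrE ?invr_gt0 // ltrNr.
Qed.

(** In the variable 1 / t the vertex is - d / e. It is the inverse of a feasible step if d <> 0, and
    is approached only as t tends to an infinity if d = 0. *)
Lemma optimal_step_dual (R : realType) (d e k : R) (r : \bar R) : e < 0 ->
  optimal_step (step_cost 0 0 d e k) r <->
  (if d == 0 then r = +oo%E \/ r = -oo%E else r = (- e / d)%:E).
Proof.
move=> e0; have a0 : 0 < - e by rewrite oppr_gt0.
have infE := @inf_step_quadratic _ (step_cost 0 0 d e k) GRing.inv
  (- e) (- d) k a0 (fun t t0 => invr_neq0 t0) (fun t _ => invrK t)
  (fun t _ => step_cost0e d e k t).
have dE : (0 = - - d / - e) <-> d = 0.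
  rewrite opprK; split=> [/esym/eqP|->]; last by rewrite mul0r.
  by rewrite mulf_eq0 invr_eq0 (gt_eqF a0) orbF => /eqP.
have fE s : s != 0 ->
    (optimal_step (step_cost 0 0 d e k) s%:E <-> s^-1 = - - d / - e).
  move=> s0; rewrite optimal_step_fin // -(quadratic_min _ k a0 (invr_neq0 s0)).
  split=> smin t t0; last first.
    by rewrite !step_cost0e; apply: smin; exact: invr_neq0.
  by have := smin _ (invr_neq0 t0); rewrite !step_cost0e invrK.
case: r => [s||].
- have [->|s0] := eqVneq s 0.
    split=> [/optimal_step_coercive0|]; first by case.
    case: eqVneq => [_ []//|d0 [/esym/eqP]].
    by rewrite mulf_eq0 invr_eq0 (gt_eqF a0) (negbTE d0).
  rewrite fE // opprK; case: eqVneq => [->|d0].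
    rewrite mul0r; split=> [/eqP|[]//].
    by rewrite invr_eq0 (negbTE s0).
  split=> [/(congr1 GRing.inv)|[->]]; rewrite ?invrK ?invf_div //.
  by move=> ->.
- rewrite /optimal_step infE.
  under eq_fun do rewrite step_cost0e.
  rewrite (quadratic_cvg_min _ _ _ a0 (@cvg_invry R)) dE.
  case: eqVneq => [d0|d0]; first by split => // _; left.
  by split=> // /eqP; rewrite (negbTE d0).
- rewrite /optimal_step infE.
  under eq_fun do rewrite step_cost0e.
  rewrite (quadratic_cvg_min _ _ _ a0 (@cvg_invrNy R)) dE.
  case: eqVneq => [d0|d0]; first by split => // _; right.
  by split=> // /eqP; rewrite (negbTE d0).
Qed.

(** * Non-trivial case with zero initialization *)

Lemma optimal_step_balanced (R : realType) (x y k : R) (r : \bar R) :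
  0 < x -> 0 < y ->
  optimal_step (step_cost (x ^+ 2) 0 0 (- y ^+ 2) k) r <->
  r = (Num.sqrt (y / x))%:E \/ r = (- Num.sqrt (y / x))%:E.
Proof.
move=> x0 y0; set s := Num.sqrt _.
have xN0 : x != 0 by rewrite gt_eqF.
have s2 : s ^+ 2 = y / x by rewrite sqr_sqrtr // divr_ge0 // ltW.
have s0 : s != 0 by rewrite gt_eqF // sqrtr_gt0 divr_gt0.
(* Completing the square as in the arithmetic-geometric mean inequality: the minimum is where x t =
   y / t. *)
have costE t : t != 0 -> step_cost (x ^+ 2) 0 0 (- y ^+ 2) k t =
    2 * x * y + k + (x * t - y / t) ^+ 2.
  by move=> t0; rewrite /step_cost; field.
have bal t : t != 0 -> (x * t - y / t) ^+ 2 = 0 <-> t = s \/ t = - s.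
  move=> t0; have -> : (x * t - y / t) ^+ 2 = (x * (t ^+ 2 - s ^+ 2) / t) ^+ 2.
    by rewrite s2; field; rewrite t0.
  split=> [/eqP|ts]; last first.
    have -> : t ^+ 2 = s ^+ 2 by case: ts => ->; rewrite ?sqrrN.
    by rewrite subrr mulr0 mul0r expr0n.
  rewrite sqrf_eq0 !mulf_eq0 invr_eq0 (negbTE xN0) (negbTE t0) orbF /=.
  by rewrite subr_eq0 eqf_sqr => /orP[]/eqP; [left|right].
rewrite optimal_step_nontrivial ?exprn_gt0 ?oppr_lt0 ?exprn_gt0 //.
split=> [[t [-> t0 tmin]]|rE].
  suff /(bal _ t0)[->|->] : (x * t - y / t) ^+ 2 = 0 by [left|right].
  apply/eqP; rewrite eq_le sqr_ge0 andbT.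
  by have := tmin _ s0; rewrite !costE // lerD2l (bal _ s0).2 //; left.
have [t [-> t0 tE]] : exists t, [/\ r = t%:E, t != 0 & t = s \/ t = - s].
  case: rE => ->; first by exists s; split=> //; left.
  by exists (- s); split; rewrite ?oppr_eq0 //; right.
exists t; split => // u u0.
by rewrite !costE // (bal _ t0).2 // addr0 lerDl sqr_ge0.
Qed.

(** * From the rate bound to the optimal step-size *)

Lemma rate_boundE (R : realType) (H K : completeNormedModType R)
    (ip : {dot K for idfun}) (A : {linear H -> K}) (x : H) (l z : K) (t : R) :
  hilbert_form ip -> t != 0 ->
  rate_bound A x l z t =
  step_cost (`|A x| ^+ 2) (- ip (A x) z) (ip l z) (- `|l| ^+ 2)
    (2 * ip (A x) l + `|z| ^+ 2) t.
Proof.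
move=> hilb t0; rewrite /rate_bound /fixed_point /step_cost -!hilb.
have sym u v : ip u v = ip v u by rewrite hermC expr0 mul1r.
rewrite !(linearDl, linearDr, linearNl, linearNr, linearZl_LR, linearZr_LR) /=.
rewrite (sym z (A x)) (sym z l) (sym l (A x)) /GRing.scale /=.
by field.
Qed.

Lemma size_quartic (R : realType) (a b d e : R) :
  (size (quartic a b d e) <= 5)%N.
Proof.
rewrite /quartic; apply/leq_sizeP => i i5; rewrite !coefE.
by case: i i5 => [|[|[|[|[|i]]]]] //= _; rewrite !mulr0 !addr0.
Qed.

Lemma quartic_first_order (R : realType) (Phi : R -> R) (a b d e k rho : R) :
  (forall t, t != 0 -> Phi t = step_cost a b d e k t) -> rho != 0 ->
  derivable Phi rho 1 /\ (derive1 Phi rho = 0 <-> root (quartic a b d e) rho).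
Proof.
move=> PhiE rho0.
have dPhi : is_derive rho 1 Phi (2 * (quartic a b d e).[rho] / rho ^+ 3).
  (* Phi and its expansion agree on the open set of nonzero reals, hence near rho. *)
  apply: near_eq_is_derive (is_derive_step_cost a b d e k rho0).
  near=> t; rewrite PhiE //; near: t.
  by apply: open_nbhs_nbhs; split; [exact: open_neq|exact: rho0].
have [dv] := dPhi; rewrite derive1E => ->; split => //.
rewrite /root; split=> [/eqP|/eqP ->]; last by rewrite mulr0 mul0r.
by rewrite !mulf_eq0 invr_eq0 expf_eq0 /= pnatr_eq0 /= (negbTE rho0) orbF.
Unshelve. all: by end_near. Qed.

Theorem mainTheorem1 (R : realType) (H P K : completeNormedModType R)
    (ipH : {dot H for idfun}) (ipP : {dot P for idfun})
    (ipK : {dot K for idfun})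
    (hilbH : hilbert_form ipH) (hilbP : hilbert_form ipP)
    (hilbK : hilbert_form ipK)
    (f : H -> \bar R) (g : P -> \bar R)
    (f_Gamma0 : Gamma0 f) (g_Gamma0 : Gamma0 g)
    (A : {linear H -> K}) (B : {linear P -> K}) (c : K)
    (A_bounded : bounded_near A (nbhs (0 : H))) (A_inj : injective A)
    (B_bounded : bounded_near B (nbhs (0 : P))) (B_inj : injective B)
    (xs : H) (zs : P) (ls : K)
    (primal : primal_solution f g A B c xs zs)
    (dual : dual_solution ipK f g A B c xs zs ls)
    (x0 : H) (l0 : K) (rho0 : R) (rho0_neq0 : rho0 != 0) :
  let zeta0 := fixed_point A x0 l0 rho0 in
  let Phi := rate_bound A xs ls zeta0 in
  let a : R := `|A xs| ^+ 2 in
  let b : R := - ipK (A xs) zeta0 in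
  let d : R := ipK ls zeta0 in
  let e : R := - `|ls| ^+ 2 in
  let p := quartic a b d e in
  [/\ (* first-order condition *)
      [/\ (size p <= 5)%N,
          forall rho : R, rho != 0 ->
            derivable Phi rho 1 /\ (derive1 Phi rho = 0 <-> root p rho)
        & forall rho : R, rho != 0 ->
            optimal_step Phi rho%:E -> root p rho],
      (* trivial case *)
      `|A xs| = 0 -> `|ls| = 0 ->
        (forall rho sigma : R, rho != 0 -> sigma != 0 ->
           Phi rho = Phi sigma) /\
        (forall r : \bar R, r != 0%:E -> optimal_step Phi r),
      (* useful primal *)
      `|A xs| != 0 -> `|ls| = 0 ->
        (zeta0 = 0 ->
           forall r : \bar R, optimal_step Phi r <-> r = 0%:E) /\
        (zeta0 != 0 ->
           forall r : \bar R, optimal_step Phi r <->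
             r = (ipK (A xs) zeta0 / `|A xs| ^+ 2)%:E),
      (* useful dual; a vanishing denominator means rho -> oo *)
      `|A xs| = 0 -> `|ls| != 0 ->
        (zeta0 = 0 ->
           forall r : \bar R, optimal_step Phi r <->
             r = +oo%E \/ r = -oo%E) /\
        (zeta0 != 0 ->
           forall r : \bar R, optimal_step Phi r <->
             (if ipK ls zeta0 == 0 then r = +oo%E \/ r = -oo%E
              else r = (`|ls| ^+ 2 / ipK ls zeta0)%:E))
    & (* non-trivial case *)
      `|A xs| != 0 -> `|ls| != 0 ->
        (zeta0 = 0 ->
           forall r : \bar R, optimal_step Phi r <->
             r = (Num.sqrt (`|ls| / `|A xs|))%:E \/
             r = (- Num.sqrt (`|ls| / `|A xs|))%:E) /\
        (zeta0 != 0 ->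
           [/\ exists rho : R, rho != 0 /\ optimal_step Phi rho%:E,
               exists q : radicals R, admissible_radicals a b d e q
             & forall q : radicals R, admissible_radicals a b d e q ->
                 map_poly (fun t : R => t%:C) p
                   = (a%:C)%:P *
                     \prod_(z <- quartic_roots a b q) ('X - z%:P) /\
                 forall r : \bar R, optimal_step Phi r <->
                   exists rho : R,
                     [/\ r = rho%:E,
                         rho%:C \in quartic_roots a b q
                       & forall sigma : R,
                           sigma%:C \in quartic_roots a b q ->
                           Phi rho <= Phi sigma]])].
Proof.
move=> zeta0 Phi a b d e p.
pose k := 2 * ipK (A xs) ls + `|zeta0| ^+ 2.
have PhiE t : t != 0 -> Phi t = step_cost a b d e k t by exact: rate_boundE.
have optE r : optimal_step Phi r <-> optimal_step (step_cost a b d e k) r.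
  exact: eq_optimal_step.
have a0 : `|A xs| = 0 -> a = 0 /\ b = 0.
  move=> Ax0; rewrite /a Ax0 expr0n; split => //.
  move: Ax0 => /eqP; rewrite normr_eq0 => /eqP Ax0.
  by rewrite /b Ax0 linear0l oppr0.
have e0 : `|ls| = 0 -> e = 0 /\ d = 0.
  move=> ls0; rewrite /e ls0 expr0n oppr0; split => //.
  by move: ls0 => /eqP; rewrite normr_eq0 => /eqP ls0; rewrite /d ls0 linear0l.
have a_gt0 : `|A xs| != 0 -> 0 < a.
  by move=> Ax0; rewrite exprn_gt0 // lt_neqAle eq_sym Ax0 normr_ge0.
have e_lt0 : `|ls| != 0 -> e < 0.
  by move=> ls0; rewrite oppr_lt0 exprn_gt0 // lt_neqAle eq_sym ls0 normr_ge0.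
have zeta00 : zeta0 = 0 -> b = 0 /\ d = 0.
  by move=> z0; rewrite /b /d z0 !linear0r oppr0.
split.
- split; first exact: size_quartic.
    by move=> rho; exact: quartic_first_order PhiE.
  by move=> rho rhoN0 /optE; exact: optimal_step_root.
- move=> /a0[aE bE] /e0[eE dE].
  have const t : t != 0 -> Phi t = k.
    by move=> t0; rewrite PhiE // /step_cost aE bE eE dE; ring.
  split=> [rho sigma rhoN0 sigmaN0|r r0]; first by rewrite !const.
  apply/(@eq_optimal_step _ Phi (fun=> k) r const).
  have infE : inf [set (fun=> k) s | s in [set s : R | s != 0]] = k.
    apply: inf_step_eq => // eps eps0; exists 1; first exact: oner_neq0.
    by rewrite ltrDl.
  rewrite /optimal_step infE; case: r r0 => [s s0|_|_]; try exact: cvg_cst.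
  by case: eqP => [sE|_] //; move: s0; rewrite sE eqxx.
- move=> Ax0 /e0[eE dE]; have aP := a_gt0 Ax0.
  have opt r : optimal_step Phi r <-> r = (- b / a)%:E.
    by rewrite optE eE dE; exact: optimal_step_primal.
  split=> z0 r; rewrite opt; last by rewrite /b opprK.
  by have [-> _] := zeta00 z0; rewrite oppr0 mul0r.
- move=> /a0[aE bE] ls0; have eN := e_lt0 ls0.
  have opt r : optimal_step Phi r <->
      (if d == 0 then r = +oo%E \/ r = -oo%E else r = (- e / d)%:E).
    by rewrite optE aE bE; exact: optimal_step_dual.
  split=> z0 r; rewrite opt; last by rewrite /e opprK.
  by have [_ ->] := zeta00 z0; rewrite eqxx.
- move=> Ax0 ls0; have aP := a_gt0 Ax0; have eN := e_lt0 ls0.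
  split=> z0.
    move=> r; rewrite optE; have [-> ->] := zeta00 z0.
    apply: optimal_step_balanced;
      by rewrite lt_neqAle eq_sym ?Ax0 ?ls0 normr_ge0.
  have aN0 : a != 0 by rewrite gt_eqF.
  (* This global minimizer is a root of p, so the list of roots contains a real one. *)
  have [s s0 smin] := step_cost_min b d k aP eN.
  have sopt : optimal_step Phi s%:E.
    by apply/optE/optimal_step_nontrivial => //; exists s.
  split; first by exists s.
    by apply: admissible_radicals_exist; rewrite // lt_eqF.
  move=> q adm; have fact := quartic_roots_factorization aN0 adm.
  split=> // r.
  have rootE t : (t%:C \in quartic_roots a b q) = root p t.
    rewrite -(fmorph_root (real_complex R)) /= fact rootM rootC fmorph_eq0.
    by rewrite (negbTE aN0) root_prod_XsubC.
  (* p(0) = e < 0, so every real root is a feasible step-size. *)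
  have root_neq0 t : root p t -> t != 0.
    apply: contraTneq => ->; rewrite /root /p /quartic.
    rewrite !(hornerD, hornerZ, hornerXn, hornerX, hornerC) !expr0n /=.
    by rewrite !mulr0 !add0r lt_eqF.
  rewrite optE optimal_step_nontrivial //; split.
    move=> [t [-> t0 tmin]]; exists t; split=> // [|u].
      rewrite rootE; apply: (@optimal_step_root _ a b d e k _ t0).
      by rewrite optimal_step_fin.
    by rewrite rootE => /root_neq0 u0; rewrite !PhiE //; exact: tmin.
  (* The best real root t is globally optimal: the minimizer s is among the roots, so Phi t <= Phi
     s. *)
  move=> [t [-> rt tmin]]; exists t.
  have t0 : t != 0 by apply: root_neq0; rewrite -rootE.
  split=> // u u0; apply: le_trans (smin u u0); rewrite -!PhiE //.
  apply: tmin; rewrite rootE; apply: (@optimal_step_root _ a b d e k _ s0).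
  exact/optE.
Qed.
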